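(* Let $f$ be the Random Plane Wave. For $\ell_1<\ell_2$ and $t_1,\dots,t_n\in\mathbb{R}^2$, $$\left(\tilde f_{\ell_1}(t_1)-\ell_1,\dots,\tilde f_{\ell_1}(t_n)-\ell_1\,\middle|\,g,\theta\right)\succ\left(\tilde f_{\ell_2}(t_1)-\ell_2,\dots,\tilde f_{\ell_2}(t_n)-\ell_2\,\middle|\,g,\theta\right),$$ that is, for any realisation of $(g,\theta)$, the conditional law of the first vector given that value of $(g,\theta)$ stochastically dominates the conditional law of the second vector given the same value of $(g,\theta)$.
   Context: The Random Plane Wave is the centred stationary Gaussian field $f:\mathbb{R}^2\to\mathbb{R}$ with covariance $\mathbb{E}(f(x)f(0))=J_0(|x|)$, where $J_n$ is the $n$-th Bessel function of the first kind. A random vector $X=(X_1,\dots,X_n)$ stochastically dominates $Y=(Y_1,\dots,Y_n)$, written $X\succ Y$, if $\mathbb{E}(h(X))\ge\mathbb{E}(h(Y))$ for any coordinate-wise increasing $h:\mathbb{R}^n\to\mathbb{R}$. $\tilde f_\ell$ denotes $f$ conditioned to have a saddle point at the origin at level $\ell$ (the limit as $\epsilon\to0$ of the Palm distribution of $f$ relative to the saddle points of $f$ with level in $[\ell,\ell+\epsilon]$). It is realised through the representation $$\tilde f_\ell(t)=g(t)+\ell\left[J_0(|t|)+2\cos(2(\theta-\arg t))J_2(|t|)\right]+\lambda_\ell\cdot4\cos(2(\theta-\arg t))J_2(|t|),$$ where $\arg t$ is the argument of $t$ (terms with $J_2(|t|)$ are $0$ at $t=0$), $g$ is a centred Gaussian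 field with covariance $\gamma(s,t)=\mathbb{E}(f(s)f(t)\,|\,f(0)=0,\nabla f(0)=0,\nabla^2f(0)=0)$, and $(\theta,\lambda_\ell)$ is a random vector independent of $g$ with density $$p_{\lambda_\ell,\theta}(x,y)\propto x(x+\ell)(2x+\ell)e^{-4x(x+\ell)}\,\mathbf{1}_{x>\max\{0,-\ell\}}\,\mathbf{1}_{y\in[0,2\pi)}.$$ (The laws of $g$ and $\theta$ do not depend on $\ell$.) *)

(* Defs.v *)
From HB Require Import structures.
From mathcomp Require Import all_boot all_order all_algebra.
From mathcomp Require Import all_classical all_reals all_analysis.

Set Implicit Arguments.
Unset Strict Implicit.
Unset Printing Implicit Defensive.

Import Order.TTheory GRing.Theory Num.Theory.
Import numFieldNormedType.Exports.

Local Open Scope classical_set_scope.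
Local Open Scope ring_scope.

Definition besselJ (R : realType) (n : nat) (x : R) : R :=
  limn (series (fun k : nat =>
    (-1) ^+ k / (k`! * (k + n)`!)%:R * (x / 2) ^+ (k.*2 + n))).

Notation plane R := (R * R)%type.

(* The library's norm on [R * R] is the sup norm. *)
Definition enorm (R : realType) (t : plane R) : R :=
  Num.sqrt (t.1 ^+ 2 + t.2 ^+ 2).

(* Principal argument, in ]-pi, pi]; the value at the origin is immaterial,
   since [arg] only occurs multiplied by [besselJ 2 (enorm t)]. *)
Definition arg (R : realType) (t : plane R) : R :=
  if 0 <= t.2 then acos (t.1 / enorm t) else - acos (t.1 / enorm t).

Definition dx (R : realType) (F : plane R -> R) : plane R -> R :=
  fun t => 'D_((1, 0) : plane R) F t.

Definition dy (R : realType) (F : plane R -> R) : plane R -> R :=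
  fun t => 'D_((0, 1) : plane R) F t.

Definition C1 (R : realType) (F : plane R -> R) : Prop :=
  [/\ forall t, derivable F t ((1, 0) : plane R),
      forall t, derivable F t ((0, 1) : plane R),
      continuous (dx F) & continuous (dy F)].

Definition C2 (R : realType) (F : plane R -> R) : Prop :=
  [/\ C1 F, C1 (dx F) & C1 (dy F)].

Notation jet R := (R * (R * R) * ((R * R) * (R * R)))%type.

(* Value, gradient and Hessian. *)
Definition jet2 (R : realType) (F : plane R -> R) (t : plane R) : jet R :=
  (F t, (dx F t, dy F t),
   ((dx (dx F) t, dy (dx F) t), (dx (dy F) t, dy (dy F) t))).

Section random_fields.
Context d (T : measurableType d) (R : realType) (P : probability T R).
Local Open Scope ereal_scope.

(* Constants are Gaussian; they are treated apart because the library's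
   [normal_prob m 0] is not the Dirac mass at [m]. *)
Definition gaussian_var (X : T -> R) : Prop :=
  (exists m : R, {ae P, forall w, X w = m}) \/
  exists m sigma : R, (0 < sigma)%R /\
    forall B : set R, measurable B -> P (X @^-1` B) = normal_prob m sigma B.

Definition centred_gaussian_field (S : Type) (f : S -> {RV P >-> R})
    (C : S -> S -> R) : Prop :=
  [/\ forall (n : nat) (a : 'I_n -> R) (s : 'I_n -> S),
        gaussian_var (fun w => \sum_(i < n) a i * f (s i) w)%R,
      forall s, 'E_P[f s] = 0
    & forall s t, covariance P (f s) (f t) = (C s t)%:E].

(* Stationarity is contained in the dependence of the covariance on [s - t]
   only.  The version with [C^2] sample paths is taken, so that the gradient
   and the Hessian of [f] make sense. *)
Definition random_plane_wave (f : plane R -> {RV P >-> R}) : Prop :=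
  centred_gaussian_field f
    (fun s t => besselJ 0 (enorm (s.1 - t.1, s.2 - t.2)%R)) /\
  forall w, C2 (fun t : plane R => f t w).

(* [c = E (Z | V = v)].  As a function of [v] a conditional expectation is
   only defined up to null sets; its value at a point is understood to be that
   of its continuous version [phi], which is determined on the support of the
   law of [V]. *)
Definition cond_expectation_at (Z : T -> R) (V : T -> jet R) (v : jet R)
    (c : R) : Prop :=
  exists2 phi : jet R -> R,
    [/\ continuous phi,
        P.-integrable setT (fun w => (phi (V w))%:E)
      & forall B : set (jet R), measurable B ->
          \int[P]_(w in V @^-1` B) (Z w)%:E =
          \int[P]_(w in V @^-1` B) (phi (V w))%:E]
  & c = phi v.

(* [gamma s t = E (f(s) f(t) | f(0) = 0, grad f(0) = 0, Hess f(0) = 0)] *)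
Definition conditioned_covariance (f : plane R -> {RV P >-> R})
    (gamma : plane R -> plane R -> R) : Prop :=
  forall s t, cond_expectation_at (fun w => f s w * f t w)%R
    (fun w => jet2 (fun u => f u w) (0, 0)%R)
    (0, (0, 0), ((0, 0), (0, 0)))%R (gamma s t).

Definition independent d1 d2 (U1 : measurableType d1) (U2 : measurableType d2)
    (X : T -> U1) (Y : T -> U2) : Prop :=
  forall A B, measurable A -> measurable B ->
    P (X @^-1` A `&` Y @^-1` B) = P (X @^-1` A) * P (Y @^-1` B).

Definition density_propto (X : T -> R * R) (p : R -> R -> R) : Prop :=
  exists2 c : R, (0 < c)%R &
    forall B : set (R * R), measurable B ->
      P (X @^-1` B) =
      c%:E * \int[lebesgue_measure \x lebesgue_measure]_(z in B)
               (p z.1 z.2)%:E.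

(* [kappa y] is the conditional law of [X] given [Y = y]. *)
Definition regular_cond_law d1 d2 (U1 : measurableType d1)
    (U2 : measurableType d2) (Y : T -> U1) (X : T -> U2)
    (kappa : R.-pker U1 ~> U2) : Prop :=
  forall A B, measurable A -> measurable B ->
    P (Y @^-1` A `&` X @^-1` B) = \int[P]_(w in Y @^-1` A) kappa (Y w) B.

End random_fields.

(* Realisations of a random field, with the sigma-algebra generated by the
   evaluation maps. *)
Definition cylinders (R : realType) : set (set (plane R -> R)) :=
  [set A | exists (t : plane R) (B : set R),
     measurable B /\ A = [set u | B (u t)]].

Notation realisation R := (g_sigma_algebraType (@cylinders R)).

(* Stochastic domination between laws on [R^n]. *)
Definition coordwise_increasing (R : realType) n (h : n.-tuple R -> R) :=
  forall x y : n.-tuple R, (forall i, tnth x i <= tnth y i) -> h x <= h y.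

Definition stoch_dominates (R : realType) n
    (mu nu : {measure set (n.-tuple R) -> \bar R}) : Prop :=
  forall h : n.-tuple R -> R,
    measurable_fun [set: n.-tuple R] h -> coordwise_increasing h ->
    mu.-integrable setT (EFin \o h) -> nu.-integrable setT (EFin \o h) ->
    (\int[nu]_x (h x)%:E <= \int[mu]_x (h x)%:E)%E.

(* The (unnormalised) density of [(lambda, theta)]. *)
Definition saddle_density (R : realType) (l x y : R) : R :=
  x * (x + l) * (2 * x + l) * expR (- (4 * x * (x + l))) *
  \1_[set x : R | Num.max 0 (- l) < x] x *
  \1_[set y : R | 0 <= y < 2 * pi] y.

Definition saddle_value (R : realType) (l : R) (g : plane R -> R)
    (theta lambda : R) (t : plane R) : R :=
  g t
  + l * (besselJ 0 (enorm t)
         + 2 * cos (2 * (theta - arg t)) * besselJ 2 (enorm t))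
  + lambda * (4 * cos (2 * (theta - arg t)) * besselJ 2 (enorm t)).

Definition saddle_vector (R : realType) (l : R) n (t : n.-tuple (plane R))
    (g : plane R -> R) (theta lambda : R) : n.-tuple R :=
  [tuple saddle_value l g theta lambda (tnth t i) - l | i < n].

(* The random elements entering the representation of the field conditioned to
   have a saddle point at the origin at level [l]; the conditioned field itself
   is [fun w => saddle_value l (g ^~ w) (theta w) (lambda w)]. *)
Definition saddle_representation d (T : measurableType d) (R : realType)
    (P : probability T R) (gamma : plane R -> plane R -> R) (l : R)
    (g : plane R -> {RV P >-> R}) (theta lambda : {RV P >-> R}) : Prop :=
  [/\ centred_gaussian_field g gamma,
      density_propto P (fun w => (lambda w, theta w)) (saddle_density l)
    & independent P ((fun w => g ^~ w) : T -> realisation R)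
        (fun w => (lambda w, theta w))].

(* [kappa (g0, theta0)] is the conditional law, given
   [(g, theta) = (g0, theta0)], of the conditioned field minus its level at
   the points [t].  The version is fixed at every realisation [(g0, theta0)]:
   [lambda] being independent of [(g, theta)], it is the law of the vector with
   [(g, theta)] frozen at [(g0, theta0)]. *)
Definition saddle_cond_law d (T : measurableType d) (R : realType)
    (P : probability T R) (l : R) (g : plane R -> {RV P >-> R})
    (theta lambda : {RV P >-> R}) n (t : n.-tuple (plane R))
    (kappa : R.-pker (realisation R * R) ~> n.-tuple R) : Prop :=
  regular_cond_law P
    ((fun w => (g ^~ w, theta w)) : T -> (realisation R * R)%type)
    (fun w => saddle_vector l t (g ^~ w) (theta w) (lambda w)) kappa /\
  forall (g0 : plane R -> R) (theta0 : R) (B : set (n.-tuple R)),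
    measurable B ->
    kappa (g0, theta0) B =
    P [set w | B (saddle_vector l t g0 theta0 (lambda w))].

(* Main.v *)
Require Import Defs.
From HB Require Import structures.
From mathcomp Require Import all_boot all_order all_algebra.
From mathcomp Require Import all_classical all_reals all_analysis.
From mathcomp Require Import measurable_realfun ring lra.

(** Write [x] for the value of [lambda] and [v = 4 x (x + l)].  Since
    [(2 x + l)^2 = v + l^2] and [2 x + l > 0], the coordinate of the
    conditioned field at [t], minus its level, is

      g t + l (J_0 - 1) + 2 c J_2 sqrt (v + l^2),   c = cos (2 (theta - arg t)),

    where [J_0], [J_2] are taken at [|t|] (lemma [saddle_vectorE]).  The density
    of [lambda] is, up to a constant, [v exp (- v)] times the derivative of [v],
    so the law of [v] is the Gamma law with tail [(1 + a) exp (- a)], whatever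
    [l] is (lemma [saddle_exponent_tail]).  Coupling the two levels through the
    same [v], it remains to see that each coordinate decreases with [l]
    (lemma [level_vector_le]).  The function [l |-> sqrt (v + l^2)] is
    1-Lipschitz and [|c| <= 1], so this follows from

      2 |J_2 (r)| <= 1 - J_0 (r)                 (lemma [besselJ0_besselJ2_le]).

    For this inequality put [y = - r^2 / 4] and let [F n y] be the sum of
    [y^k / (k! (k + n)!)], so that [J_n (r) = (r / 2)^n F n y], [F n] has
    derivative [F n.+1], and [F n y = (n + 1) F n.+1 y + y F n.+2 y].  With
    [a = F 0 y], [b = F 1 y] the inequality reads [0 <= 1 + a - 2 b] and
    [0 <= 1 - 3 a + 2 b].  For [r <= 6] it is checked on partial sums of the
    alternating series.  For [r >= 6] one uses the energy [a^2 - y b^2], that is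
    [J_0^2 + J_1^2], which is nonincreasing in [r] because its derivative in
    [y] is [b^2]: it is at most its value at [r = 6], which is small enough for
    the Cauchy-Schwarz inequality to conclude.

    Finally, [lambda] is independent of [(g, theta)]: it is independent of
    [theta] because the joint density is a product, and the pair
    [(lambda, theta)] is independent of [g].  Hence the law of the vector with
    [(g, theta)] frozen is a regular version of the conditional law
    (lemma [frozen_regular_cond_law]). *)

Set Implicit Arguments.
Unset Strict Implicit.
Unset Printing Implicit Defensive.

Import Order.TTheory GRing.Theory Num.Theory.
Import numFieldNormedType.Exports.

Local Open Scope classical_set_scope.
Local Open Scope ring_scope.

(** * Alternating series and the Bessel-Clifford functions *)

(** The remainder of an alternating series has the sign of its first term, as
    soon as the absolute values decrease from that term on. *)
Lemma alternating_series_remainder (R : realType) (u : R^nat) (m : nat) (l : R) :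
  (forall k, 0 <= u k) -> (forall k, (m <= k)%N -> u k.+1 <= u k) ->
  series (fun k => (-1) ^+ k * u k) @ \oo --> l ->
  0 <= (-1) ^+ m * (l - series (fun k => (-1) ^+ k * u k) m).
Proof.
move=> u0 ud ul; set S := series _ in ul *.
(* Invariant: the partial remainder of length [j] is nonnegative, and for odd
   [j] it is at least the absolute value of its last term. *)
have Sd j : 0 <= (-1) ^+ m * (S (m + j)%N - S m) /\
    (odd j -> u (m + j).-1 <= (-1) ^+ m * (S (m + j)%N - S m)).
  elim: j => [|j [IH1 IH2]]; first by rewrite addn0 subrr mulr0.
  rewrite addnS /= /S /series/= big_nat_recr//= -/(series _ _) -/S.
  have -> : (-1) ^+ m * (S (m + j)%N + (-1) ^+ (m + j) * u (m + j)%N - S m) =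
      (-1) ^+ m * (S (m + j)%N - S m) + (-1) ^+ j * u (m + j)%N.
    rewrite addrAC mulrDr exprD !mulrA -expr2 sqrr_sign mul1r//.
  have [oj|ej] := boolP (odd j).
    rewrite -[_ ^+ j]signr_odd oj expr1 mulN1r; split => //.
    rewrite subr_ge0 (le_trans _ (IH2 oj))//.
    by case: j oj {IH1 IH2} => // j _; rewrite addnS/= ud// leq_addr.
  rewrite -[_ ^+ j]signr_odd (negbTE ej) expr0 mul1r.
  by split; rewrite ?addr_ge0// lerDr.
have cv : (-1) ^+ m * (S (j + m)%N - S m) @[j --> \oo] --> (-1) ^+ m * (l - S m).
  apply: cvgM; [exact: cvg_cst | apply: cvgB; [|exact: cvg_cst]].
  by rewrite cvg_shiftn.
rewrite -(cvg_lim (@Rhausdorff R) cv); apply: limr_ge.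
  by apply/cvg_ex; eexists; exact: cv.
by apply: nearW => j; rewrite addnC; case: (Sd j).
Qed.

(** Coefficients [1 / (k! (k + n)!)] of the Bessel-Clifford functions. *)
Definition bessel_coef (R : realType) (n k : nat) : R := ((k`! * (k + n)`!)%:R)^-1.

(** The Bessel-Clifford function of order [n], normalised so that
    [J_n (r) = (r / 2)^n * bessel_clifford n (- (r / 2)^2)]. *)
Definition bessel_clifford (R : realType) (n : nat) (y : R) : R :=
  limn (pseries (bessel_coef R n) y).

Section bessel_clifford.
Context {R : realType}.
Implicit Types (x y r : R) (n k : nat).
Local Notation beta := (bessel_coef R).
Local Notation F := (@bessel_clifford R).

Lemma bessel_coef_ge0 n k : 0 <= beta n k.
Proof. by rewrite invr_ge0. Qed.

Lemma bessel_coefS n k : beta n k.+1 = beta n k / (k.+1%:R * (k.+1 + n)%:R).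
Proof.
rewrite /bessel_coef factS addSn factS -invfM -!natrM.
by congr (_ %:R^-1); rewrite mulnACA mulnC.
Qed.

Lemma bessel_coef0 n : beta n 0 = (n`!%:R)^-1.
Proof. by rewrite /bessel_coef fact0 mul1n. Qed.

Lemma pseries_diffs_bessel_coef n : pseries_diffs (beta n) = beta n.+1.
Proof.
apply/funext => k; rewrite /pseries_diffs /bessel_coef factS -mulnA natrM invfM.
by rewrite mulrA divff// mul1r addSnnS.
Qed.

Lemma is_cvg_bessel_series n y : cvgn (pseries (beta n) y).
Proof.
apply: normed_cvg.
apply: (series_le_cvg _ _ _ (is_cvg_series_exp_coeff `|y|)) => k //=.
  by rewrite /exp_coeff/= divr_ge0 ?exprn_ge0.
rewrite /exp_coeff/= normrM normrX ger0_norm ?bessel_coef_ge0// mulrC.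
rewrite ler_wpM2l ?exprn_ge0// lef_pV2 ?posrE ?ltr0n ?muln_gt0 ?fact_gt0//.
by rewrite ler_nat leq_pmulr ?fact_gt0.
Qed.

Arguments is_cvg_bessel_series : clear implicits.

Lemma is_derive_bessel_clifford n y : is_derive y 1 (F n) (F n.+1 y).
Proof.
rewrite /bessel_clifford -pseries_diffs_bessel_coef.
apply: (@pseries_snd_diffs _ _ (`|y| + 1)).
- exact: is_cvg_bessel_series.
- by rewrite pseries_diffs_bessel_coef; exact: is_cvg_bessel_series.
- by rewrite !pseries_diffs_bessel_coef; exact: is_cvg_bessel_series.
- by rewrite [ltRHS]ger0_norm// ltrDl.
Qed.

Lemma bessel_clifford_rec n y :
  F n y = n.+1%:R * F n.+1 y + y * F n.+2 y.
Proof.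
rewrite /bessel_clifford -(pseries_diffs_bessel_coef n.+1).
have h1 : n.+1%:R * series (fun k => beta n.+1 k * y ^+ k) m @[m --> \oo] -->
    n.+1%:R * limn (pseries (beta n.+1) y).
  by apply: cvgM; [exact: cvg_cst | exact: is_cvg_bessel_series].
have h2 : y * series (fun k => k%:R * beta n.+1 k * y ^+ k.-1) m @[m --> \oo] -->
    y * limn (pseries (pseries_diffs (beta n.+1)) y).
  apply: cvgM; [exact: cvg_cst | apply: pseries_diffs_equiv].
  by rewrite pseries_diffs_bessel_coef; exact: is_cvg_bessel_series.
apply/cvg_lim => //; apply: cvg_trans (cvgD h1 h2).
apply: near_eq_cvg; near=> m.
rewrite fctE /pseries /series /= !big_distrr/= -big_split/=; apply: eq_bigr => k _.
have -> : y * (k%:R * beta n.+1 k * y ^+ k.-1) = k%:R * beta n.+1 k * y ^+ k.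
  case: k => [|k]; first by rewrite !mul0r mulr0.
  by rewrite exprS; ring.
rewrite !mulrA -mulrDl; congr (_ * _).
rewrite -mulrDl -natrD /bessel_coef addnS factS mulnCA natrM invfM.
by rewrite mulrA addSn addnC divff// mul1r.
Unshelve. all: by end_near. Qed.

Lemma besselJE n r :
  besselJ n r = (r / 2) ^+ n * F n (- (r / 2) ^+ 2).
Proof.
rewrite /besselJ; apply/cvg_lim => //.
have h : (r / 2) ^+ n * pseries (beta n) (- (r / 2) ^+ 2) m @[m --> \oo] -->
    (r / 2) ^+ n * F n (- (r / 2) ^+ 2).
  by apply: cvgM; [exact: cvg_cst | exact: is_cvg_bessel_series].
apply: cvg_trans h; apply: near_eq_cvg; near=> m.
rewrite /pseries /series /= big_distrr/=; apply: eq_bigr => k _.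
move: (r / 2) => a; rewrite /bessel_coef exprD -mul2n exprM.
by rewrite -(mulN1r (a ^+ 2)) exprMn; ring.
Unshelve. all: by end_near. Qed.

(** On [[0, 9]] the terms of the series at [- x] decrease in absolute value
    from index 2 on, since the ratio of consecutive terms is
    [x / ((k + 1) (k + 1 + n))]. *)
Lemma bessel_clifford_alternating n m x : (1 < m)%N -> 0 <= x <= 9 ->
  0 <= (-1) ^+ m * (F n (- x) - pseries (beta n) (- x) m).
Proof.
move=> m1 /andP[x0 x9].
have E : (fun k => beta n k * (- x) ^+ k) = (fun k => (-1) ^+ k * (beta n k * x ^+ k)).
  by apply/funext => k; rewrite -(mulN1r x) exprMn; ring.
have C := is_cvg_bessel_series n (- x).
rewrite /bessel_clifford; move: C; rewrite /pseries E => C.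
apply: alternating_series_remainder C => k.
  by rewrite mulr_ge0 ?bessel_coef_ge0 ?exprn_ge0.
move=> mk; rewrite bessel_coefS exprS.
have -> : beta n k / (k.+1%:R * (k.+1 + n)%:R) * (x * x ^+ k) =
   (beta n k * x ^+ k) * (x / (k.+1%:R * (k.+1 + n)%:R)) by ring.
rewrite ler_piMr ?mulr_ge0 ?bessel_coef_ge0 ?exprn_ge0//.
rewrite ler_pdivrMr ?mulr_gt0 ?ltr0n ?addn_gt0// mul1r (le_trans x9)//.
rewrite -natrM (ler_nat _ 9) (@leq_trans (3 * 3)%N)// leq_mul//.
  by rewrite ltnS (leq_trans m1).
by rewrite (@leq_trans k.+1) ?leq_addr// ltnS (leq_trans m1).
Qed.

Lemma bessel_clifford_le n m x : (1 < m)%N -> odd m -> 0 <= x <= 9 ->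
  F n (- x) <= pseries (beta n) (- x) m.
Proof.
move=> m1 om x9; have := bessel_clifford_alternating n m1 x9.
by rewrite -signr_odd om mulN1r oppr_ge0 subr_le0.
Qed.

Lemma bessel_clifford_ge n m x : (1 < m)%N -> ~~ odd m -> 0 <= x <= 9 ->
  pseries (beta n) (- x) m <= F n (- x).
Proof.
move=> m1 /negbTE om x9; have := bessel_clifford_alternating n m1 x9.
by rewrite -signr_odd om mul1r subr_ge0.
Qed.

(** Horner form of the partial sums: the sum of the [m] terms from index [k] on,
    divided by the term of index [k].  It keeps every numeral small. *)
Fixpoint bessel_horner (n m k : nat) (y : R) : R :=
  if m is m'.+1 then 1 + y / (k.+1%:R * (k.+1 + n)%:R) * bessel_horner n m' k.+1 y
  else 0.

Lemma pseries_bessel_horner n m y :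
  pseries (beta n) y m = (n`!%:R)^-1 * bessel_horner n m 0 y.
Proof.
suff H k : \sum_(k <= i < k + m) beta n i * y ^+ i =
    beta n k * y ^+ k * bessel_horner n m k y.
  by rewrite /pseries /series /= (H 0%N) expr0 mulr1 bessel_coef0.
elim: m k => [|m IH] k; first by rewrite addn0 big_geq// mulr0.
rewrite big_ltn ?addnS ?ltnS ?leq_addr// -addSn IH /= bessel_coefS exprS.
ring.
Qed.

(** The polynomial that bounds the right-hand side from below is a nonnegative
    combination of the products [x ^ i (9 - x) ^ j] with [i + j = 6], which is
    its expansion in the Bernstein basis of [[0, 9]]; in the next lemma it is
    one of those with [i + j = 8]. *)
Lemma bessel_bound_small_ge x : 0 <= x <= 9 -> 0 <= 1 + F 0 (- x) - 2 * F 1 (- x).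
Proof.
move=> x9; have /andP[x0 y0] := x9.
have := bessel_clifford_ge 0 (isT : (1 < 6)%N) isT x9.
have := bessel_clifford_le 1 (isT : (1 < 7)%N) isT x9.
rewrite !pseries_bessel_horner /= !fact0 !factS fact0.
rewrite !addn0 !addn1 !mul1n !invr1 !mul1r => h1 h2.
have m i j : 0 <= x ^+ i * (9 - x) ^+ j by rewrite mulr_ge0 ?exprn_ge0// subr_ge0.
have := m 2%N 4%N; have := m 3%N 3%N; have := m 4%N 2%N.
have := m 5%N 1%N; have := m 6%N 0%N.
lra.
Qed.

Lemma bessel_bound_small_le x : 0 <= x <= 9 -> 0 <= 1 - 3 * F 0 (- x) + 2 * F 1 (- x).
Proof.
move=> x9; have /andP[x0 y0] := x9.
have := bessel_clifford_le 0 (isT : (1 < 9)%N) isT x9.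
have := bessel_clifford_ge 1 (isT : (1 < 8)%N) isT x9.
rewrite !pseries_bessel_horner /= !fact0 !factS fact0.
rewrite !addn0 !addn1 !mul1n !invr1 !mul1r => h1 h2.
have m i j : 0 <= x ^+ i * (9 - x) ^+ j by rewrite mulr_ge0 ?exprn_ge0// subr_ge0.
have := m 1%N 7%N; have := m 2%N 6%N; have := m 3%N 5%N; have := m 4%N 4%N.
have := m 5%N 3%N; have := m 6%N 2%N; have := m 7%N 1%N; have := m 8%N 0%N.
lra.
Qed.

(** [J_0 (r)^2 + J_1 (r)^2], as a function of [y = - (r / 2)^2]. *)
Definition bessel_energy y := F 0 y ^+ 2 - y * F 1 y ^+ 2.

Lemma bessel_energy_nondecreasing x y : x <= y -> bessel_energy x <= bessel_energy y.
Proof.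
have D (z : R) : is_derive z (1 : R) bessel_energy (F 1 z ^+ 2).
  have d0 := is_derive_bessel_clifford 0 z; have d1 := is_derive_bessel_clifford 1 z.
  apply: is_derive_eq.
  by rewrite /GRing.scale /= (bessel_clifford_rec 0); ring.
move=> xy.
apply: (@ger0_derive1_ndecr _ bessel_energy x y) => //.
- by move=> z _; rewrite derive1E derive_val sqr_ge0.
- by apply: derivable_within_continuous.
Qed.

(** The value [x = 9] corresponds to [r = 6]; in the lemma after this one the
    bound is only needed to be at most [1 / (9 + 4 / 9)]. *)
Lemma bessel_energy_le x : 9 <= x -> bessel_energy (- x) <= 105 / 1000.
Proof.
move=> x9; have /bessel_energy_nondecreasing/le_trans : - x <= - 9 by rewrite lerN2.
apply.
have n9 : (0 <= 9 :> R) && (9 <= 9 :> R) by rewrite lexx andbT.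
have := bessel_clifford_le 0 (isT : (1 < 9)%N) isT n9.
have := bessel_clifford_ge 0 (isT : (1 < 10)%N) isT n9.
have := bessel_clifford_le 1 (isT : (1 < 9)%N) isT n9.
have := bessel_clifford_ge 1 (isT : (1 < 10)%N) isT n9.
rewrite /bessel_energy !pseries_bessel_horner /= !fact0 !factS fact0.
rewrite !addn0 !addn1 !mul1n !invr1 !mul1r => h1 h2 h3 h4.
have h1' : - (923 / (1000 * 10)) <= F 1 (- 9) by apply: le_trans h1; lra.
have h2' : F 1 (- 9) <= - (919 / (1000 * 10)) by apply: le_trans h2 _; lra.
have h3' : 15 / 100 <= F 0 (- 9) by apply: le_trans h3; lra.
have h4' : F 0 (- 9) <= 154 / 1000 by apply: le_trans h4 _; lra.
nra.
Qed.

Lemma bessel_bound_large x : 9 <= x ->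
  0 <= 1 + F 0 (- x) - 2 * F 1 (- x) /\ 0 <= 1 - 3 * F 0 (- x) + 2 * F 1 (- x).
Proof.
move=> x9; have := bessel_energy_le x9; rewrite /bessel_energy.
set a := F 0 _; set b := F 1 _ => E.
have x0 : 0 < x by rewrite (lt_le_trans _ x9).
(* Cauchy-Schwarz for the vectors [(a, sqrt x * b)] and [(c, - 2 / sqrt x)]. *)
have cs c : c ^+ 2 <= 9 -> `|c * a - 2 * b| <= 1.
  move=> c9; rewrite -(expr_le1 (n := 2))// -normrX ger0_norm ?sqr_ge0//.
  apply: (@le_trans _ _ ((c ^+ 2 + 4 / x) * (a ^+ 2 - - x * b ^+ 2))).
    rewrite -subr_ge0.
    have -> : (c ^+ 2 + 4 / x) * (a ^+ 2 - - x * b ^+ 2) - (c * a - 2 * b) ^+ 2 =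
        (2 * a + c * x * b) ^+ 2 / x by field; rewrite gt_eqF.
    by rewrite divr_ge0 ?sqr_ge0// ltW.
  apply: (@le_trans _ _ ((9 + 4 / 9) * (105 / 1000))); last by lra.
  apply: ler_pM => //.
  - by rewrite addr_ge0 ?sqr_ge0// divr_ge0// ltW.
  - rewrite mulNr opprK; apply: addr_ge0; first exact: sqr_ge0.
    by apply: mulr_ge0; [exact: ltW|exact: sqr_ge0].
  - by rewrite lerD// ler_pM2l// lef_pV2 ?posrE.
have := cs 1; have := cs 3; rewrite !ler_norml => h3 h1.
have /andP[] : - 1 <= 3 * a - 2 * b <= 1 by apply: h3; lra.
have /andP[] : - 1 <= 1 * a - 2 * b <= 1 by apply: h1; lra.
by split; lra.
Qed.

(** Equivalently, [J_0 + 2 s J_2 <= 1] for every [s] in [[-1, 1]]. *)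
Lemma besselJ0_besselJ2_le r : 2 * `|besselJ 2 r| <= 1 - besselJ 0 r.
Proof.
rewrite !besselJE; set x := (r / 2) ^+ 2.
have x0 : 0 <= x by rewrite sqr_ge0.
have := bessel_clifford_rec 0 (- x); rewrite expr0 !mul1r => E.
have -> : x * F 2 (- x) = F 1 (- x) - F 0 (- x) by rewrite E; ring.
have [A B] : 0 <= 1 + F 0 (- x) - 2 * F 1 (- x) /\
    0 <= 1 - 3 * F 0 (- x) + 2 * F 1 (- x).
  have [x9|x9] := leP x 9; last by apply: bessel_bound_large; exact: ltW.
  by split; [apply: bessel_bound_small_ge|apply: bessel_bound_small_le]; rewrite x0.
by have [] := ger0P (F 1 (- x) - F 0 (- x)) => _; lra.
Qed.
End bessel_clifford.

(** * Conditional laws obtained by freezing an independent variable *)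

Section frozen_kernel.
Context d0 d1 d2 d3 (T : measurableType d0) (U : measurableType d1)
  (W : measurableType d2) (Z : measurableType d3) (R : realType).
Variables (P : probability T R) (X : {mfun T >-> W}) (phi : {mfun (U * W)%type >-> Z}).

Let measurable_frozen y : measurable_fun setT (fun w => phi (y, X w)).
Proof.
apply: measurableT_comp; first exact: measurable_funPT.
by apply/measurable_fun_pairP; split; [exact: measurable_cst | exact: measurable_funPT].
Qed.

(** The random variable [phi (y, X)], with [y] frozen. *)
Definition frozen_rv (y : U) : {mfun T >-> Z} :=
  HB.pack (fun w => phi (y, X w))
    (isMeasurableFun.Build _ _ _ _ _ (measurable_frozen y)).

(** The law of [phi (y, X)], as a probability kernel in [y]. *)
Definition frozen_law (y : U) : {measure set Z -> \bar R} :=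
  distribution P (frozen_rv y).

Lemma frozen_lawE y B : measurable B ->
  frozen_law y B = distribution P X (xsection (phi @^-1` B) y).
Proof.
move=> mB; rewrite /frozen_law /distribution /pushforward; congr (P _).
by apply/seteqP; split => w /=; rewrite /xsection/= inE.
Qed.

Let measurable_frozen_law B : measurable B ->
  measurable_fun [set: U] (frozen_law ^~ B).
Proof.
move=> mB; rewrite (_ : (fun y => _) = distribution P X \o xsection (phi @^-1` B)).
  apply: measurable_fun_xsection; exact: measurable_funPTI.
by apply/funext => y /=; rewrite frozen_lawE.
Qed.

HB.instance Definition _ := isKernel.Build _ _ _ _ _ frozen_law measurable_frozen_law.

Let frozen_law_setT y : frozen_law y setT = 1%E.
Proof. exact: probability_setT. Qed.

HB.instance Definition _ :=
  Kernel_isProbability.Build _ _ _ _ _ frozen_law frozen_law_setT.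

Lemma independent_joint_law (Y : {mfun T >-> U}) : independent P Y X ->
  forall S, measurable S ->
  P [set w | S (Y w, X w)] = (distribution P Y \x distribution P X)%E S.
Proof.
move=> YX S mS.
have mYX : measurable_fun setT (fun w => (Y w, X w)).
  by apply/measurable_fun_pairP; split; exact: measurable_funPT.
pose V : {mfun T >-> (U * W)%type} := HB.pack (fun w => (Y w, X w))
  (isMeasurableFun.Build _ _ _ _ _ mYX).
by rewrite (@product_measure_unique _ _ _ _ _ _ _ (distribution P V)).
Qed.

(** If [X] is independent of [Y], the law of [phi (y, X)] is a regular version
    of the conditional law of [phi (Y, X)] given [Y = y]. *)
Lemma frozen_regular_cond_law (Y : {mfun T >-> U}) : independent P Y X ->
  regular_cond_law P Y (fun w => phi (Y w, X w)) frozen_law.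
Proof.
move=> YX A B mA mB.
have mphiB : measurable (phi @^-1` B) by exact: measurable_funPTI.
have := independent_joint_law YX (measurableI _ _ (measurableX mA measurableT) mphiB).
rewrite [X in P X = _ -> _](_ : _ =
    Y @^-1` A `&` (fun w => phi (Y w, X w)) @^-1` B); last first.
  by apply/seteqP; split => w /=; [move=> [[? _] ?]|move=> [? ?]; split => //].
move=> ->.
have -> : (\int[P]_(w in Y @^-1` A) frozen_law (Y w) B =
    \int[distribution P Y]_(y in A) frozen_law y B)%E.
  rewrite ge0_integral_pushforward//.
  by apply: measurable_funTS; exact: measurable_frozen_law.
rewrite [LHS]/product_measure1 /= [RHS]integral_mkcond; apply: eq_integral => y _.
rewrite /= patchE; case: ifPn => [yA|yA].
  rewrite frozen_lawE//; congr (distribution P X _).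
  apply/seteqP; split => w; rewrite /xsection /= !inE; first by case.
  by move=> ?; split => //; split => //; rewrite inE in yA.
rewrite [S in distribution P X S](_ : _ = set0) ?measure0//.
apply/seteqP; split => w //; rewrite /xsection /= inE => -[[yA' _] _].
by rewrite notin_setE in yA.
Qed.

End frozen_kernel.

Lemma independent_pair d d1 d2 d3 (T : measurableType d) (U : measurableType d1)
    (V : measurableType d2) (W : measurableType d3) (R : realType)
    (P : probability T R) (G : {mfun T >-> U}) (X : {mfun T >-> V})
    (Y : {mfun T >-> W}) :
  independent P G (fun w => (X w, Y w)) -> independent P X Y ->
  independent P (fun w => (G w, Y w)) X.
Proof.
move=> GXY XY A L mA mL.
have mXY : measurable_fun setT (fun w => (X w, Y w)).
  by apply/measurable_fun_pairP; split; exact: measurable_funPT.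
pose Z : {mfun T >-> (V * W)%type} := HB.pack (fun w => (X w, Y w))
  (isMeasurableFun.Build _ _ _ _ _ mXY).
have GZ : independent P G Z by [].
pose S L := [set z : U * (V * W) | A (z.1, z.2.2) /\ L z.2.1].
have mS L0 : measurable L0 -> measurable (S L0).
  move=> mL0; rewrite (_ : S L0 =
    (fun z : U * (V * W) => ((z.1, z.2.2), z.2.1)) @^-1` (A `*` L0))//.
  have m : measurable_fun setT (fun z : U * (V * W) => ((z.1, z.2.2), z.2.1)).
    apply/measurable_fun_pairP; split.
      apply/measurable_fun_pairP; split; first exact: measurable_fst.
      exact: (measurableT_comp measurable_snd measurable_snd).
    exact: (measurableT_comp measurable_fst measurable_snd).
  by rewrite -[X in measurable X]setTI; apply: m => //; exact: measurableX.
(* Both factors of the product law of [X] and [Y] appear once [(X, Y)] has been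
   separated from [G]; taking [L0 := setT] identifies the integral. *)
have key L0 : measurable L0 ->
    P ((fun w => (G w, Y w)) @^-1` A `&` X @^-1` L0) =
    (P (X @^-1` L0) * \int[distribution P G]_g P (Y @^-1` xsection A g))%E.
  move=> mL0; transitivity ((distribution P G \x distribution P Z)%E (S L0)).
    by rewrite -independent_joint_law//; exact: mS.
  rewrite [LHS]/product_measure1 /= -ge0_integralZl//; last first.
    by apply: (measurable_fun_xsection (distribution P Y)).
  apply: eq_integral => g _ /=.
  have mAg : measurable (xsection A g) by exact: measurable_xsection.
  rewrite -XY//; congr (P _).
  by apply/seteqP; split => w; rewrite /xsection /= !inE => -[].
rewrite key// muleC; congr (_ * _)%E.
have := key setT measurableT; rewrite !preimage_setT setIT probability_setT mul1e.
by move=> <-.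
Qed.

(** * Measurability of the saddle vector, and stochastic domination *)

(** Coupling criterion: two laws that are images of a common law [M] under
    coordinatewise ordered maps are stochastically ordered. *)
Lemma stoch_dominates_monotone_image d (X : measurableType d) (R : realType) n
    (M : probability X R) (V W : {mfun X >-> n.-tuple R})
    (mu nu : {measure set (n.-tuple R) -> \bar R}) :
  (forall B, measurable B -> mu B = distribution M V B) ->
  (forall B, measurable B -> nu B = distribution M W B) ->
  (forall x i, tnth (W x) i <= tnth (V x) i) ->
  stoch_dominates mu nu.
Proof.
move=> muE nuE WV h mh hinc hmu hnu.
have transfer (m : {measure set (n.-tuple R) -> \bar R}) (S : {mfun X >-> n.-tuple R}) :
    (forall B, measurable B -> m B = distribution M S B) ->
    m.-integrable setT (EFin \o h) ->
    M.-integrable setT (EFin \o (h \o S)) /\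
    (\int[m]_x (h x)%:E = \int[M]_x (h (S x))%:E)%E.
  move=> mE /integrableP[mfh hfin].
  have mfhS : measurable_fun setT (EFin \o (h \o S)).
    exact: (measurableT_comp mfh (measurable_funPT S)).
  have hS : M.-integrable setT (EFin \o (h \o S)).
    apply/integrableP; split => //.
    rewrite (eq_measure_integral (distribution M S)) in hfin; last first.
      by move=> A mA _; exact: mE.
    rewrite ge0_integral_pushforward// in hfin.
    exact: measurableT_comp.
  split => //.
  rewrite (eq_measure_integral (distribution M S)); last by move=> A mA _; exact: mE.
  by rewrite integral_pushforward.
have [iV ->] := transfer mu V muE hmu.
have [iW ->] := transfer nu W nuE hnu.
apply: le_integral => // x _; rewrite lee_fin; apply: hinc; exact: WV.
Qed.

Section realisations.
Context {R : realType}.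

Lemma measurable_evaluation (s : plane R) :
  measurable_fun setT (fun u : realisation R => (u : plane R -> R) s).
Proof.
move=> _ B mB; rewrite setTI; apply: sub_sigma_algebra.
by exists s, B.
Qed.

Lemma measurable_realisation d (T : measurableType d) (g : plane R -> T -> R) :
  (forall s, measurable_fun setT (g s)) ->
  measurable_fun setT ((fun w => g ^~ w) : T -> realisation R).
Proof.
move=> mg; apply: (@measurability _ _ T (realisation R) setT _ (@cylinders R)) => //.
move=> _ [_ [s [B [mB ->]]] <-].
by rewrite setTI -[X in measurable X]setTI; exact: mg.
Qed.

Lemma measurable_cosine (c : R) : measurable_fun setT (fun y : R => cos (2 * (y - c))).
Proof.
apply: measurableT_comp.
  by apply: continuous_measurable_fun; exact: continuous_cos.
by apply: measurable_funM => //; apply: measurable_funB.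
Qed.

Lemma measurable_saddle_vector (l : R) n (t : n.-tuple (plane R)) :
  measurable_fun setT (fun z : realisation R * R * R =>
    saddle_vector l t z.1.1 z.1.2 z.2).
Proof.
apply/measurable_fun_tnthP => i.
rewrite (_ : _ \o _ = fun z : realisation R * R * R =>
  saddle_value l z.1.1 z.1.2 z.2 (tnth t i) - l); last first.
  by apply/funext => z /=; rewrite tnth_mktuple.
have mc : measurable_fun setT (fun z : realisation R * R * R =>
    cos (2 * (z.1.2 - arg (tnth t i)))).
  exact: (measurableT_comp (measurable_cosine (arg (tnth t i)))
    (measurableT_comp measurable_snd measurable_fst)).
apply: measurable_funB => //; rewrite /saddle_value.
apply: measurable_funD.
  apply: measurable_funD.
    exact: (measurableT_comp (measurable_evaluation (tnth t i))
      (measurableT_comp measurable_fst measurable_fst)).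
  apply: measurable_funM => //; apply: measurable_funD => //.
  by apply: measurable_funM => //; apply: measurable_funM.
apply: measurable_funM; first exact: measurable_snd.
by apply: measurable_funM => //; apply: measurable_funM.
Qed.

End realisations.

(** * Laws with a product density *)

Lemma finite_measure_eq_itvcy (R : realType)
    (m1 m2 : {finite_measure set R -> \bar R}) :
  (forall a : R, m1 `[a, +oo[%classic = m2 `[a, +oo[%classic) ->
  forall A, measurable A -> m1 A = m2 A.
Proof.
move=> m12 A mA.
apply: (@g_sigma_algebra_measure_unique _ _ _ (@RGenCInfty.G R) _
    (fun k => `[- k%:R, +oo[%classic)) => //.
- by move=> _ [x ->]; exact: measurable_itv.
- by move=> k; exists (- k%:R).
- apply/seteqP; split => // x _; exists (Num.truncn `|x|).+1 => //=.
  rewrite in_itv/= andbT lerNl (le_trans (ler_norm _))// normrN.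
  by rewrite ltW// truncnS_gt.
- move=> _ _ [x ->] [y ->]; exists (Num.max x y).
  by apply/seteqP; split => z /=; rewrite !in_itv/= !andbT ge_max => /andP.
- by move=> _ [x ->]; exact: m12.
- by move=> k; rewrite -ge0_fin_numE// fin_num_measure.
- by have <- : measurable = <<s @RGenCInfty.G R>> := RGenCInfty.measurableE R.
Qed.

Section product_density.
Context d (T : measurableType d) (R : realType) (P : probability T R).
Variables (X Y : {RV P >-> R}) (q r : R -> R).
Hypotheses (mq : measurable_fun setT q) (mr : measurable_fun setT r).
Hypotheses (q0 : forall x, 0 <= q x) (r0 : forall x, 0 <= r x).
Hypothesis XY : density_propto P (fun w => (X w, Y w)) (fun x y => q x * r y).
Local Notation mu := (@lebesgue_measure R).
Local Open Scope ereal_scope.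

(** The law of [(X, Y)] is, up to a factor, the product of the two weights. *)
Lemma product_densityE : exists2 c : R, (0 < c)%R &
  forall A B, measurable A -> measurable B ->
  P (X @^-1` A `&` Y @^-1` B) =
    c%:E * (\int[mu]_(x in A) (q x)%:E * \int[mu]_(y in B) (r y)%:E).
Proof.
have [c c0 cE] := XY; exists c => // A B mA mB.
have := cE _ (measurableX mA mB).
rewrite [X in P X = _ -> _](_ : _ = X @^-1` A `&` Y @^-1` B)//.
move=> ->; congr (_ * _).
have mAB : measurable (A `*` B) by exact: measurableX.
have mf : measurable_fun setT (fun z : R * R => (q z.1 * r z.2)%:E).
  apply/measurable_EFinP; apply: measurable_funM.
    exact: (measurableT_comp mq measurable_fst).
  exact: (measurableT_comp mr measurable_snd).
rewrite integral_mkcond fubini_tonelli1/=; last 2 first.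
- by apply/(measurable_restrictT _ _).1 => //; exact: measurable_funTS.
- by apply: erestrict_ge0 => z _; rewrite lee_fin mulr_ge0.
rewrite -ge0_integralZr//=; last 3 first.
- by apply/measurable_EFinP; exact: measurable_funTS.
- by move=> x _; rewrite lee_fin.
- by apply: integral_ge0 => y _; rewrite lee_fin.
rewrite [RHS]integral_mkcond; apply: eq_integral => x _.
rewrite /fubini_F /= [in RHS]patchE; case: ifPn => xA.
  rewrite -ge0_integralZl//=; last 3 first.
  - by apply/measurable_EFinP; exact: measurable_funTS.
  - by move=> y _; rewrite lee_fin.
  - by rewrite lee_fin.
  rewrite [RHS]integral_mkcond; apply: eq_integral => y _.
  rewrite !patchE; rewrite in_setX/= xA/=.
  by case: ifPn.
apply: integral0_eq => y _; rewrite patchE in_setX/= (negbTE xA)//.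
Qed.

Lemma product_density_independent : independent P X Y.
Proof.
have [c c0 cE] := product_densityE => A B mA mB.
have := cE setT setT measurableT measurableT.
have := cE A setT mA measurableT; have := cE setT B measurableT mB.
rewrite !preimage_setT setTI !setIT probability_setT cE// => -> -> h1.
set qA := integral mu A _; set rB := integral mu B _.
rewrite -[LHS]mule1 h1.
set qT := integral mu setT _; set rT := integral mu setT _.
by rewrite muleACA [RHS]muleACA; congr (_ * _); rewrite muleACA [RHS]muleACA (muleC rB).
Qed.

Lemma product_density_marginal : exists k : \bar R, forall A, measurable A ->
  P (X @^-1` A) = k * \int[mu]_(x in A) (q x)%:E.
Proof.
have [c c0 cE] := product_densityE.
exists (c%:E * \int[mu]_(y in setT) (r y)%:E) => A mA.
have := cE A setT mA measurableT; rewrite preimage_setT setIT => ->.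
by rewrite (muleC (integral mu A _)) muleA.
Qed.
End product_density.

(** * The law of [4 lambda (lambda + l)] *)

Section saddle_weight.
Context {R : realType}.
Implicit Types (l x a : R).
Local Notation mu := (@lebesgue_measure R).

(** The quantity whose law does not depend on the level. *)
Definition saddle_exponent l x : R := 4 * x * (x + l).

(** The factor of the density of [(lambda, theta)] that depends on [lambda]. *)
Definition saddle_weight l x : R :=
  x * (x + l) * (2 * x + l) * expR (- saddle_exponent l x) *
  \1_[set x : R | Num.max 0 (- l) < x] x.

Lemma measurable_saddle_exponent l : measurable_fun setT (saddle_exponent l).
Proof. by apply: measurable_funM; [apply: measurable_funM|apply: measurable_funD]. Qed.

Lemma saddle_weight_out l x : ~ Num.max 0 (- l) < x -> saddle_weight l x = 0.
Proof. by move=> h; rewrite /saddle_weight indicE memNset ?mulr0. Qed.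

Lemma saddle_weight_in l x : Num.max 0 (- l) < x ->
  saddle_weight l x = x * (x + l) * (2 * x + l) * expR (- saddle_exponent l x).
Proof. by move=> h; rewrite /saddle_weight indicE mem_set// mulr1. Qed.

Lemma saddle_weight_ge0 l x : 0 <= saddle_weight l x.
Proof.
have [|/negP] := boolP (Num.max 0 (- l) < x); last by move=> /saddle_weight_out ->.
move=> h; rewrite saddle_weight_in//; move: h; rewrite gt_max => /andP[x0 xl].
by rewrite !mulr_ge0 ?expR_ge0//; lra.
Qed.

Lemma measurable_saddle_weight l : measurable_fun setT (saddle_weight l).
Proof.
apply: measurable_funM; last first.
  apply: measurable_indic.
  rewrite (_ : [set x | _] = `]Num.max 0 (- l), +oo[%classic)//.
  by apply/seteqP; split => x /=; rewrite in_itv/= andbT.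
apply: measurable_funM; last first.
  apply: measurableT_comp => //; apply: measurableT_comp => //.
  exact: measurable_saddle_exponent.
by repeat (apply: measurable_funM || apply: measurable_funD).
Qed.

(** The weight lives on [x > max 0 (- l)]. *)
Lemma integral_saddle_weight_eq l (A B : set R) :
  (forall x, Num.max 0 (- l) < x -> A x <-> B x) ->
  (\int[mu]_(x in A) (saddle_weight l x)%:E =
   \int[mu]_(x in B) (saddle_weight l x)%:E)%E.
Proof.
move=> AB; rewrite integral_mkcond [RHS]integral_mkcond; apply: eq_integral => x _.
rewrite !patchE.
have [h|/negP/saddle_weight_out ->] := boolP (Num.max 0 (- l) < x); last first.
  by do 2 case: ifP.
suff -> : (x \in A) = (x \in B) by [].
by apply/idP/idP; rewrite !inE => /AB; apply.
Qed.

(** The tail of the unnormalised Gamma law of shape 2; the factor 1/16 comes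
    from [x (x + l) (2 x + l) dx = v dv / 16] for [v = 4 x (x + l)]. *)
Definition gamma_tail a : R := (1 + a) * expR (- a) / 16.

(* A primitive of the weight on its support. *)
Let F l x := - gamma_tail (saddle_exponent l x).

Let is_derive_F l x : is_derive x 1 (F l)
  (x * (x + l) * (2 * x + l) * expR (- saddle_exponent l x)).
Proof.
rewrite /F /gamma_tail /saddle_exponent.
apply: is_derive_eq.
by rewrite /GRing.scale /=; field.
Qed.

Let cvg_F l : F l x @[x --> +oo] --> (0 : R).
Proof.
rewrite -oppr0; apply: cvgN.
apply: (@squeeze_cvgr _ _ _ _ (cst 0) (fun x => x^-1)).
- near=> x.
  have x1 : 1 <= x by near: x; apply: nbhs_pinfty_ge; rewrite num_real.
  have xl : 1 - l <= x by near: x; apply: nbhs_pinfty_ge; rewrite num_real.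
  set u := saddle_exponent l x.
  have u4 : 4 * x <= u by rewrite /u /saddle_exponent ler_peMr; lra.
  have eu : u ^+ 2 / 2 <= expR u.
    have := @expR_ge1Dxn _ u 1; rewrite (_ : 2`!%:R = 2)//.
    by move=> /(_ ltac:(lra)); lra.
  apply/andP; split => //=.
    by rewrite /gamma_tail divr_ge0// mulr_ge0 ?expR_ge0//; lra.
  rewrite /gamma_tail expRN ler_pdivrMr// ler_pdivrMr ?expR_gt0//.
  rewrite -mulrA ler_pdivlMl; last by lra.
  nra.
- exact: cvg_cst.
- apply/gtr0_cvgV0; last exact: cvg_id.
  by near=> x; near: x; apply: nbhs_pinfty_gt; rewrite num_real.
Unshelve. all: by end_near. Qed.

Lemma integral_saddle_weight_tail l a :
  (\int[mu]_(x in [set x | (a <= saddle_exponent l x)%R]) (saddle_weight l x)%:E =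
   (gamma_tail (Num.max a 0)%R)%:E)%E.
Proof.
set b := Num.max a 0; have b0 : 0 <= b by rewrite le_max lexx orbT.
(* On the support, [saddle_exponent l x >= b] amounts to [x >= s]. *)
set s := (Num.sqrt (b + l ^+ 2) - l) / 2.
have s2 : (2 * s + l) ^+ 2 = b + l ^+ 2.
  rewrite (_ : 2 * s + l = Num.sqrt (b + l ^+ 2)); last by rewrite /s; field.
  by rewrite sqr_sqrtr// addr_ge0// sqr_ge0.
have ls : `|l| <= 2 * s + l.
  rewrite (_ : 2 * s + l = Num.sqrt (b + l ^+ 2)); last by rewrite /s; field.
  by rewrite -sqrtr_sqr ler_wsqrtr// lerDr.
have es : saddle_exponent l s = b by rewrite /saddle_exponent; nra.
have ms : Num.max 0 (- l) <= s.
  move: ls; rewrite ler_norml => /andP[? ?].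
  by rewrite ge_max; apply/andP; split; lra.
rewrite (@integral_saddle_weight_eq l _ `[s, +oo[%classic); last first.
  move=> x; rewrite gt_max => /andP[x0 xl] /=; rewrite in_itv/= andbT.
  have u0 : 0 <= saddle_exponent l x by rewrite /saddle_exponent !mulr_ge0//; lra.
  rewrite (_ : (a <= saddle_exponent l x) = (b <= saddle_exponent l x)); last first.
    by rewrite /b ge_max u0 andbT.
  rewrite -es /saddle_exponent; move: ms; rewrite ge_max => /andP[s0 sl].
  split => [h|h]; last by nra.
  by rewrite leNgt; apply/negP => xs; nra.
transitivity (\int[mu]_(x in `[s, +oo[)
    (x * (x + l) * (2 * x + l) * expR (- saddle_exponent l x))%:E)%E.
  apply: eq_integral => x; rewrite inE/= in_itv/= andbT => sx.
  have [h|h] := boolP (Num.max 0 (- l) < x); first by rewrite saddle_weight_in.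
  rewrite saddle_weight_out; last exact/negP.
  have -> : x = Num.max 0 (- l).
    by apply/eqP; rewrite eq_le leNgt h (le_trans ms).
  by case: (leP 0 (- l)) => _; rewrite ?addNr ?mulr0 ?mul0r.
have cont : continuous (fun x =>
    x * (x + l) * (2 * x + l) * expR (- saddle_exponent l x)).
  move=> x; apply: differentiable_continuous; apply/derivable1_diffP.
  by rewrite /saddle_exponent; apply: ex_derive.
rewrite (@ge0_continuous_FTC2y _ _ (F l) s 0).
- by rewrite /F es -EFinB sub0r opprK.
- move=> x sx; move: ms; rewrite ge_max => /andP[s0 sl].
  by rewrite !mulr_ge0 ?expR_ge0//; lra.
- exact: continuous_subspaceT.
- exact: cvg_F.
- by [].
- apply: cvg_at_right_filter; apply: differentiable_continuous.
  by apply/derivable1_diffP; have ? := is_derive_F l s; apply: ex_derive.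
- by move=> x _; have ? := is_derive_F l x; rewrite derive1E derive_val.
Qed.
End saddle_weight.

Section saddle_law.
Context d (T : measurableType d) (R : realType) (P : probability T R).
Variables (l : R) (lambda theta : {RV P >-> R}).
Hypothesis lt_density :
  density_propto P (fun w => (lambda w, theta w)) (saddle_density l).

Let angle_weight (y : R) : R := \1_[set y : R | 0 <= y < 2 * pi] y.

Let measurable_angle_weight : measurable_fun setT angle_weight.
Proof.
apply: measurable_indic; rewrite (_ : [set y | _] = `[0, 2 * pi[%classic).
  exact: measurable_itv.
by apply/seteqP; split => y /=; rewrite in_itv.
Qed.

Let angle_weight_ge0 y : 0 <= angle_weight y.
Proof. by rewrite /angle_weight indicE. Qed.

Lemma saddle_independent : independent P lambda theta.
Proof.
apply: (@product_density_independent _ _ _ _ _ _ (saddle_weight l) angle_weight) => //.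
- exact: measurable_saddle_weight.
- exact: saddle_weight_ge0.
Qed.

Lemma saddle_marginal : exists k : \bar R, forall A, measurable A ->
  P (lambda @^-1` A) =
    (k * \int[lebesgue_measure]_(x in A) (saddle_weight l x)%:E)%E.
Proof.
apply: (@product_density_marginal _ _ _ _ _ theta (saddle_weight l) angle_weight) => //.
- exact: measurable_saddle_weight.
- exact: saddle_weight_ge0.
Qed.

Lemma saddle_marginal_eq (A B : set R) : measurable A -> measurable B ->
  (forall x, Num.max 0 (- l) < x -> A x <-> B x) ->
  P (lambda @^-1` A) = P (lambda @^-1` B).
Proof.
have [k kE] := saddle_marginal => mA mB AB.
by rewrite !kE// (integral_saddle_weight_eq AB).
Qed.

(** The law of [4 lambda (lambda + l)] does not depend on [l]: its tail at
    [a >= 0] is [(1 + a) exp (- a)].  The normalising constant of the density is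
    determined by the case [a = 0], where the probability is 1. *)
Lemma saddle_exponent_tail a :
  P [set w | a <= saddle_exponent l (lambda w)] =
  (16 * gamma_tail (Num.max a 0))%:E.
Proof.
have [k kE] := saddle_marginal.
have mS b : measurable [set x | b <= saddle_exponent l x].
  rewrite (_ : mkset _ = saddle_exponent l @^-1` `[b, +oo[%classic); last first.
    by apply/seteqP; split => x /=; rewrite in_itv/= andbT.
  by rewrite -[X in measurable X]setTI; exact: measurable_saddle_exponent.
have tailE b : P [set w | b <= saddle_exponent l (lambda w)] =
    (k * (gamma_tail (Num.max b 0))%:E)%E.
  by rewrite -(integral_saddle_weight_tail l) -kE.
have k16 : (k * (16^-1)%:E)%E = 1%E.
  have <- : P (lambda @^-1` setT) = 1%E by rewrite preimage_setT probability_setT.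
  rewrite (@saddle_marginal_eq setT [set x | 0 <= saddle_exponent l x])//.
    rewrite [RHS]tailE maxxx /gamma_tail oppr0 expR0 addr0 mul1r.
    by rewrite div1r.
  move=> x; rewrite gt_max => /andP[x0 xl]; split => // _ /=.
  by rewrite /saddle_exponent !mulr_ge0//; lra.
rewrite tailE -[in LHS](@mulfK _ (16 : R) _ (gamma_tail _))//.
by rewrite mulrC EFinM muleA k16 mul1e mulrC.
Qed.

End saddle_law.

(** * Monotonicity in the level *)

Section level_vector.
Context {R : realType}.
Implicit Types (l v : R).

(** The vector of values minus the level, in terms of [v = 4 lambda (lambda + l)].
    The truncation [max v 0] is harmless, [v] being almost surely positive, and
    makes the comparison of two levels hold for every real [v]. *)
Definition level_vector l n (t : n.-tuple (plane R)) (g : plane R -> R)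
    (theta v : R) : n.-tuple R :=
  [tuple g (tnth t i) + l * (besselJ 0 (enorm (tnth t i)) - 1)
     + 2 * cos (2 * (theta - arg (tnth t i))) * besselJ 2 (enorm (tnth t i))
         * Num.sqrt (Num.max v 0 + l ^+ 2) | i < n].

Lemma measurable_level_vector l n (t : n.-tuple (plane R)) g theta :
  measurable_fun setT (level_vector l t g theta).
Proof.
apply/measurable_fun_tnthP => i.
rewrite (_ : _ \o _ = fun v => g (tnth t i) + l * (besselJ 0 (enorm (tnth t i)) - 1)
     + 2 * cos (2 * (theta - arg (tnth t i))) * besselJ 2 (enorm (tnth t i))
         * Num.sqrt (Num.max v 0 + l ^+ 2)); last first.
  by apply/funext => v /=; rewrite tnth_mktuple.
apply: measurable_funD => //; apply: measurable_funM => //.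
apply: measurableT_comp.
  by apply: continuous_measurable_fun; exact: sqrt_continuous.
by apply: measurable_funD => //; apply: measurable_maxr.
Qed.

Lemma saddle_vectorE l n (t : n.-tuple (plane R)) g theta x :
  Num.max 0 (- l) < x ->
  saddle_vector l t g theta x = level_vector l t g theta (saddle_exponent l x).
Proof.
rewrite gt_max => /andP[x0 xl]; apply: eq_from_tnth => i; rewrite !tnth_mktuple.
have -> : Num.max (saddle_exponent l x) 0 = saddle_exponent l x.
  by apply/max_idPl; rewrite /saddle_exponent !mulr_ge0//; lra.
have -> : saddle_exponent l x + l ^+ 2 = (2 * x + l) ^+ 2.
  by rewrite /saddle_exponent; ring.
rewrite sqrtr_sqr ger0_norm; last by lra.
by rewrite /saddle_value; ring.
Qed.

Lemma sqrt_addr_sqr_dist (v l1 l2 : R) : 0 <= v ->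
  `|Num.sqrt (v + l1 ^+ 2) - Num.sqrt (v + l2 ^+ 2)| <= `|l1 - l2|.
Proof.
move=> v0; rewrite -(ler_pXn2r (n := 2)) ?nnegrE// -!normrX !ger0_norm ?sqr_ge0//.
have e1 := sqr_sqrtr (addr_ge0 v0 (sqr_ge0 l1)).
have e2 := sqr_sqrtr (addr_ge0 v0 (sqr_ge0 l2)).
have s1 := sqrtr_ge0 (v + l1 ^+ 2); have s2 := sqrtr_ge0 (v + l2 ^+ 2).
move: e1 e2 s1 s2; set s := Num.sqrt _; set s' := Num.sqrt _ => e1 e2 s1 s2.
suff : v + l1 * l2 <= s * s' by nra.
have [h|h] := leP 0 (v + l1 * l2); last by rewrite (le_trans (ltW h))// mulr_ge0.
rewrite -(ler_pXn2r (n := 2)) ?nnegrE ?mulr_ge0// exprMn e1 e2.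
have := mulr_ge0 v0 (sqr_ge0 (l1 - l2)); nra.
Qed.

(** The coefficient of the difference of the square roots is at most
    [1 - J_0] in absolute value, and the square root is 1-Lipschitz in [l]. *)
Lemma level_vector_le l1 l2 n (t : n.-tuple (plane R)) g theta v (i : 'I_n) :
  l1 < l2 ->
  tnth (level_vector l2 t g theta v) i <= tnth (level_vector l1 t g theta v) i.
Proof.
move=> l12; rewrite !tnth_mktuple.
have v0 : 0 <= Num.max v 0 by rewrite le_max lexx orbT.
set r := enorm _; set c := cos _.
set s1 := Num.sqrt (_ + l1 ^+ 2); set s2 := Num.sqrt _.
have J := besselJ0_besselJ2_le r.
have ds : `|s2 - s1| <= l2 - l1.
  by rewrite (le_trans (sqrt_addr_sqr_dist _ _ v0))// gtr0_norm ?subr_gt0.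
have c1 : `|c| <= 1 by rewrite ler_norml cos_geN1 cos_le1.
have : `|2 * c * besselJ 2 r * (s2 - s1)| <= (l2 - l1) * (1 - besselJ 0 r).
  rewrite normrM mulrC; apply: ler_pM => //.
  rewrite (le_trans _ J)// -mulrA !normrM ger0_norm// ler_pM2l//.
  by rewrite ler_piMl.
by rewrite ler_norml => /andP[_ h]; nra.
Qed.

End level_vector.

(** The conditional law of the statement, given at every realisation as the image
    under [level_vector] of the law of [4 lambda (lambda + l)]. *)
Lemma exists_saddle_cond_law d (T : measurableType d) (R : realType)
    (P : probability T R) (gamma : plane R -> plane R -> R) l
    (g : plane R -> {RV P >-> R}) (theta lambda : {RV P >-> R})
    n (t : n.-tuple (plane R)) :
  saddle_representation gamma l g theta lambda ->
  exists2 kappa : R.-pker (realisation R * R) ~> n.-tuple R,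
    saddle_cond_law l g theta lambda t kappa &
    forall g0 theta0 B, measurable B -> kappa (g0, theta0) B =
      P [set w | B (level_vector l t g0 theta0 (saddle_exponent l (lambda w)))].
Proof.
move=> [_ ltd gind].
pose phi : {mfun (realisation R * R * R)%type >-> n.-tuple R} :=
  HB.pack (fun z : realisation R * R * R => saddle_vector l t z.1.1 z.1.2 z.2)
    (isMeasurableFun.Build _ _ _ _ _ (measurable_saddle_vector l t)).
have mg : measurable_fun setT ((fun w => g ^~ w) : T -> realisation R).
  by apply: measurable_realisation => s; exact: measurable_funPT.
pose G : {mfun T >-> realisation R} := HB.pack ((fun w => g ^~ w) : T -> realisation R)
  (isMeasurableFun.Build _ _ _ _ _ mg).
have mY : measurable_fun setT (fun w => (G w, theta w)).
  by apply/measurable_fun_pairP; split; exact: measurable_funPT.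
pose Y : {mfun T >-> (realisation R * R)%type} := HB.pack (fun w => (G w, theta w))
  (isMeasurableFun.Build _ _ _ _ _ mY).
have YX : independent P Y lambda.
  apply: (@independent_pair _ _ _ _ _ _ _ _ _ _ G lambda theta) => //.
  exact: (saddle_independent ltd).
exists (frozen_law P lambda phi : R.-pker (realisation R * R) ~> n.-tuple R).
  by split => //; exact: (frozen_regular_cond_law phi YX).
move=> g0 theta0 B mB.
have mS := measurableT_comp (measurable_saddle_vector l t)
  (measurable_pair1 (g0, theta0)).
have mL := measurableT_comp (measurable_level_vector l t g0 theta0)
  (measurable_saddle_exponent l).
apply: (saddle_marginal_eq ltd (A := [set x | B (saddle_vector l t g0 theta0 x)])
  (B := [set x | B (level_vector l t g0 theta0 (saddle_exponent l x))])).
- by have := mS measurableT B mB; rewrite setTI.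
- by have := mL measurableT B mB; rewrite setTI.
- by move=> x lx /=; rewrite saddle_vectorE.
Qed.

Theorem lemma5p5 (R : realType)
  (d0 : measure_display) (T0 : measurableType d0) (P0 : probability T0 R)
  (f : plane R -> {RV P0 >-> R}) (hf : random_plane_wave f)
  (gamma : plane R -> plane R -> R) (hgamma : conditioned_covariance f gamma)
  (l1 l2 : R) (l12 : l1 < l2)
  (d1 : measure_display) (T1 : measurableType d1) (P1 : probability T1 R)
  (g1 : plane R -> {RV P1 >-> R}) (theta1 lambda1 : {RV P1 >-> R})
  (h1 : saddle_representation gamma l1 g1 theta1 lambda1)
  (d2 : measure_display) (T2 : measurableType d2) (P2 : probability T2 R)
  (g2 : plane R -> {RV P2 >-> R}) (theta2 lambda2 : {RV P2 >-> R})
  (h2 : saddle_representation gamma l2 g2 theta2 lambda2)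
  (n : nat) (t : n.-tuple (plane R)) :
  exists kappa1 kappa2 : R.-pker (realisation R * R) ~> n.-tuple R,
    [/\ saddle_cond_law l1 g1 theta1 lambda1 t kappa1,
        saddle_cond_law l2 g2 theta2 lambda2 t kappa2
      & forall (g0 : plane R -> R) (theta0 : R), 0 <= theta0 < 2 * pi ->
          stoch_dominates (kappa1 (g0, theta0)) (kappa2 (g0, theta0))].
Proof.
have [kappa1 c1 k1E] := exists_saddle_cond_law t h1.
have [kappa2 c2 k2E] := exists_saddle_cond_law t h2.
exists kappa1, kappa2; split => // g0 theta0 _.
have mU d (T : measurableType d) (P : probability T R) l (lambda : {RV P >-> R}) :
    measurable_fun setT (fun w => saddle_exponent l (lambda w)).
  exact: (measurableT_comp (measurable_saddle_exponent l) (measurable_funPT lambda)).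
pose U1 : {RV P1 >-> R} := HB.pack (fun w => saddle_exponent l1 (lambda1 w))
  (isMeasurableFun.Build _ _ _ _ _ (mU _ _ _ l1 lambda1)).
pose U2 : {RV P2 >-> R} := HB.pack (fun w => saddle_exponent l2 (lambda2 w))
  (isMeasurableFun.Build _ _ _ _ _ (mU _ _ _ l2 lambda2)).
(* The two laws have the same tails. *)
have U12 A : measurable A -> distribution P1 U1 A = distribution P2 U2 A.
  apply: finite_measure_eq_itvcy => a.
  have [_ ltd1 _] := h1; have [_ ltd2 _] := h2.
  change (P1 (U1 @^-1` `[a, +oo[%classic) = P2 (U2 @^-1` `[a, +oo[%classic)).
  rewrite !preimage_itvcy.
  by rewrite (saddle_exponent_tail ltd1) (saddle_exponent_tail ltd2).
pose V l : {mfun R >-> n.-tuple R} := HB.pack (level_vector l t g0 theta0)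
  (isMeasurableFun.Build _ _ _ _ _ (measurable_level_vector l t g0 theta0)).
apply: (@stoch_dominates_monotone_image _ _ _ _ (distribution P1 U1) (V l1) (V l2)).
- by move=> B mB; rewrite k1E.
- move=> B mB; rewrite k2E//.
  by rewrite [RHS]U12//; exact: measurable_funPTI.
- by move=> v i; exact: level_vector_le.
Qed.
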